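(* Let $X$ be a real Banach space with norm $\|\cdot\|$, and let $\Phi: X\to\mathbb{R}$ be a locally Lipschitz functional. For $z_0,z_1\in X$ define $$\Gamma:=\{c\in C^0([0,1];X): c(0)=z_0,\ c(1)=z_1\},\qquad \gamma:=\inf_{c\in\Gamma}\max_{0\le t\le 1}\Phi(c(t)),$$ and set $\Phi_\gamma:=\{x\in X:\Phi(x)\ge\gamma\}$. If $F\subset X$ is a closed, norm-bounded subset such that $F\cap\Phi_\gamma$ separates $z_0$ and $z_1$, then there exists a sequence $\{x_n\}\subset X$ such that $$d(x_n,F)\to 0,\qquad \Phi(x_n)\to\gamma,\qquad (1+\|x_n\|)\min_{y^*\in\partial\Phi(x_n)}\|y^*\|\to 0 .$$
   Context: $C^0([0,1];X)$ is the space of continuous maps from $[0,1]$ to $X$, and $d(x,F):=\inf_{y\in F}\|x-y\|$. Clarke generalized gradient: for a locally Lipschitz $\Phi:X\to\mathbb{R}$, the generalized directional derivative is $\Phi^0(x,v):=\limsup_{w\to x,\ t\downarrow 0}\frac{\Phi(w+tv)-\Phi(w)}{t}$, and $\partial\Phi(x):=\{x^*\in X^*:\langle x^*,v\rangle\le\Phi^0(x,v)\ \forall v\in X\}$. Separation: a closed set $S\subset X$ separates $z_0$ and $z_1$ if $X\setminus S=\Omega_0\cup\Omega_1$ with $\Omega_0,\Omega_1$ open, $\Omega_0\cap\Omega_1=\emptyset$, $z_0\in\Omega_0$ and $z_1\in\Omega_1$. *)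

(* Defs.v *)
From HB Require Import structures.
From mathcomp Require Import all_boot all_order all_algebra.
From mathcomp Require Import all_classical all_reals all_analysis.

Set Implicit Arguments.
Unset Strict Implicit.
Unset Printing Implicit Defensive.
Import Order.TTheory GRing.Theory Num.Theory.
Import numFieldNormedType.Exports.
Local Open Scope classical_set_scope.
Local Open Scope ring_scope.

Definition is_minimum (R : realType) (A : set R) (m : R) : Prop :=
  A m /\ lbound A m.

Definition is_maximum (R : realType) (A : set R) (m : R) : Prop :=
  A m /\ ubound A m.

Section Banach.
Context {R : realType} {X : completeNormedModType R}.
Implicit Types (Phi : X -> R) (S F : set X) (x v z : X).

Definition locally_lipschitz Phi : Prop :=
  forall x, exists2 U : set X, nbhs x U & [lipschitz Phi y | y in U].

(* A real infimum: the value is meaningful for nonempty F only. *)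
Definition dist_to x F : R := inf [set `|x - y| | y in F].

(* Extended-real valued; finite when Phi is locally Lipschitz.
   0^'+ is the filter of right neighbourhoods of 0, with 0 excluded. *)
Definition clarke_derivative Phi x v : \bar R :=
  limf_esup (fun wt : X * R => ((Phi (wt.1 + wt.2 *: v) - Phi wt.1) / wt.2)%:E)
            (filter_prod (nbhs x) 0^'+).

(* The elements of the topological dual of X are the f : {linear X -> R^o}
   such that continuous f. *)
Definition clarke_gradient Phi x : set {linear X -> R^o} :=
  [set f : {linear X -> R^o} |
    continuous f /\ forall v, ((f v : R)%:E <= clarke_derivative Phi x v)%E].

Definition dual_norm (f : {linear X -> R^o}) : R :=
  sup [set `|f v : R| | v in [set v : X | `|v| <= 1]].

Definition separates S z0 z1 : Prop :=
  closed S /\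
  exists O0 O1 : set X,
    [/\ ~` S = O0 `|` O1, open O0 /\ open O1, O0 `&` O1 = set0, O0 z0 & O1 z1].

(* A map [0, 1] -> X is represented by c : R -> X; the values of c outside
   [0, 1] are irrelevant. *)
Definition paths z0 z1 : set (R -> X) :=
  [set c : R -> X | [/\ {within `[0, 1], continuous c}, c 0 = z0 & c 1 = z1]].

Definition minimax_value Phi z0 z1 : R :=
  inf [set m | exists2 c, paths z0 z1 c &
                 is_maximum [set Phi (c t) | t in `[0, 1]] m].

Definition superlevel Phi (a : R) : set X := [set x | a <= Phi x].

End Banach.

(* Main.v *)
Require Import Defs.
From HB Require Import structures.
From mathcomp Require Import all_boot all_order all_algebra.
From mathcomp Require Import all_classical all_reals all_analysis.
From mathcomp Require Import finmap ring lra.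

(* Since F is bounded, the factor 1 + |x| is harmless, so it suffices to find,
   for each e > 0, a point x close to F and at a level close to gamma with
   -e <= Phi^0(x, v) for all |v| <= 1; by Hahn-Banach this bounds the least norm
   in the Clarke gradient by e.

   Assume there is no such x, and let S be the separating set. Perturb Phi to
   phi = Phi + k max(0, rho - d(., S)) with k = e / 2. Every path meets S, so
   max phi o c >= gamma + k rho, while a nearly optimal path c0 has
   max Phi o c0 <= gamma + k rho / 2. The Brezis-Browder principle (Ekeland's
   argument), applied to pairs (c, a) with phi o c <= a and c = c0 wherever c0
   is at distance >= rho from S, gives a pair that cannot be improved at rate k.
   The parameters t with phi (c t) = a then correspond to points near S at level
   near gamma, so at each of them Phi decreases at rate > e = 2k in some
   direction; gluing these directions by a partition of unity on [0, 1] lowers a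
   at rate k, a contradiction. Working with an upper bound a in place of the
   maximum of phi o c avoids any metric on the space of paths. *)

Set Implicit Arguments.
Unset Strict Implicit.
Unset Printing Implicit Defensive.
Import Order.TTheory GRing.Theory Num.Theory.
Import numFieldNormedType.Exports.
Local Open Scope classical_set_scope.
Local Open Scope ring_scope.

(** * Hahn-Banach *)

Definition sublinear (R : realType) (V : lmodType R) (q : V -> R) : Prop :=
  (forall x y, q (x + y) <= q x + q y) /\
  (forall (a : R) x, 0 < a -> q (a *: x) = a * q x).

Section HahnBanach.
Context {R : realType} {V : lmodType R}.
Implicit Types (p q : V -> R) (x y w : V) (K : set (V * R)).

Lemma sublinear0 q : sublinear q -> q 0 = 0.
Proof.
move=> [_ qZ]; have := qZ 2 0 (ltr0Sn _ 1); rewrite scaler0 => q2.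
lra.
Qed.

Lemma sublinearN q x : sublinear q -> - q (- x) <= q x.
Proof.
move=> sq; have := sq.1 x (- x); rewrite subrr sublinear0// => h.
by rewrite -subr_ge0 opprK.
Qed.

(* The infimal convolution of q with the function whose epigraph is the convex
   cone K. *)
Definition cone_infconv q K x : R := inf [set q (x + k.1) + k.2 | k in K].

Section cone_infconv.
Variables (q : V -> R) (K : set (V * R)).
Hypothesis sub_q : sublinear q.
Hypothesis K0 : K (0, 0).
Hypothesis KD : forall k l, K k -> K l -> K (k.1 + l.1, k.2 + l.2).
Hypothesis KZ : forall a k, 0 < a -> K k -> K (a *: k.1, a * k.2).
Hypothesis qK : forall k, K k -> 0 <= q k.1 + k.2.

(** Subadditivity at [- x] and [x + k.1], together with [qK], gives the lower bound [- q (- x)]. *)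
Let has_inf_conv x : has_inf [set q (x + k.1) + k.2 | k in K].
Proof.
split; first by exists (q (x + 0) + 0), (0, 0).
exists (- q (- x)) => _ [k Kk <-].
have := sub_q.1 (- x) (x + k.1); rewrite addKr => h.
by have := qK Kk; lra.
Qed.

Lemma cone_infconv_le x k : K k -> cone_infconv q K x <= q (x + k.1) + k.2.
Proof. by move=> Kk; apply: ge_inf; [exact: (has_inf_conv x).2|exists k]. Qed.

Lemma cone_infconv_sublinear : sublinear (cone_infconv q K).
Proof.
have ge x (m : R) : (forall k, K k -> m <= q (x + k.1) + k.2) ->
    m <= cone_infconv q K x.
  by move=> h; apply: lb_le_inf; [exact: (has_inf_conv x).1|move=> _ [k /h + <-]].
split=> [x y|a x a0].
  rewrite -lerBlDr; apply: (ge) => k Kk; rewrite lerBlDl -lerBlDr.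
  apply: (ge) => l Kl; rewrite lerBlDr.
  apply: (le_trans (cone_infconv_le _ (KD Kk Kl))) => /=.
  have := sub_q.1 (x + k.1) (y + l.1).
  by rewrite addrACA; lra.
(* One inequality for all positive factors is enough: used with [a^-1] at [a *: x] it yields the
   reverse one. *)
have aux b y : 0 < b -> cone_infconv q K (b *: y) <= b * cone_infconv q K y.
  move=> b0; rewrite mulrC -ler_pdivrMr//; apply: (ge) => k Kk.
  rewrite ler_pdivrMr//; apply: (le_trans (cone_infconv_le _ (KZ b0 Kk))) => /=.
  by rewrite -scalerDr sub_q.2// mulrC mulrDl mulrC lerD2l mulrC.
apply/eqP; rewrite eq_le aux//= mulrC -ler_pdivlMr// mulrC.
have /(_ _) := aux a^-1 (a *: x); rewrite invr_gt0 scalerA mulVf ?gt_eqF// scale1r.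
exact.
Qed.

End cone_infconv.

(** Chains are bounded by their pointwise infimum, finite since each member is at least [- p (- x)]
    at [x]. For subadditivity, the smaller of two members serves at both points. *)
Lemma chain_inf_sublinear p (C : set (V -> R)) :
  C !=set0 -> (forall q, C q -> sublinear q /\ forall x, q x <= p x) ->
  (forall q q', C q -> C q' ->
    (forall x, q x <= q' x) \/ (forall x, q' x <= q x)) ->
  exists2 q, sublinear q & forall q', C q' -> forall x, q x <= q' x.
Proof.
move=> [q0 Cq0] Cp Ctot.
have hinf x : has_inf [set q x | q in C].
  split; first by exists (q0 x), q0.
  exists (- p (- x)) => _ [q Cq <-].
  have [sq qp] := Cp _ Cq.
  by apply: le_trans (sublinearN _ sq); rewrite lerN2.
have leC q x : C q -> inf [set q x | q in C] <= q x.
  by move=> Cq; apply: ge_inf; [exact: (hinf x).2|exists q].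
have ge x (m : R) : (forall q, C q -> m <= q x) -> m <= inf [set q x | q in C].
  by move=> h; apply: lb_le_inf; [exact: (hinf x).1|move=> _ [q /h + <-]].
exists (fun x => inf [set q x | q in C]); last by move=> q Cq x; exact: leC.
split=> [x y|a x a0].
  rewrite -lerBlDr; apply: (ge) => q Cq; rewrite lerBlDl -lerBlDr.
  apply: (ge) => q' Cq'; rewrite lerBlDr.
  have [h|h] := Ctot _ _ Cq Cq'.
    have := (Cp _ Cq).1.1 x y; have := leC _ (x + y) Cq; have := h y; lra.
  have := (Cp _ Cq').1.1 x y; have := leC _ (x + y) Cq'; have := h x; lra.
have aux b y : 0 < b ->
    inf [set q (b *: y) | q in C] <= b * inf [set q y | q in C].
  move=> b0; rewrite mulrC -ler_pdivrMr//; apply: (ge) => q Cq.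
  by rewrite ler_pdivrMr// mulrC -((Cp _ Cq).1.2 _ _ b0); exact: leC.
apply/eqP; rewrite eq_le aux//= mulrC -ler_pdivlMr// mulrC.
have := aux a^-1 (a *: x); rewrite invr_gt0 scalerA mulVf ?gt_eqF// scale1r.
exact.
Qed.

(* A minimal sublinear functional is odd, hence linear: otherwise it could be
   lowered by an infimal convolution along the half-line through x. *)
Lemma minimal_sublinear_odd q : sublinear q ->
  (forall q', sublinear q' -> (forall x, q' x <= q x) -> q' = q) ->
  forall x, q (- x) = - q x.
Proof.
move=> sq qmin x.
pose K := [set k : V * R | exists2 t : R, 0 <= t & k = (t *: x, - (t * q x))].
have K0 : K (0, 0) by exists 0 => //; rewrite scale0r mul0r oppr0.
have qt t : 0 <= t -> q (t *: x) = t * q x.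
  rewrite le_eqVlt => /predU1P[<-|/sq.2//].
  by rewrite scale0r sublinear0// mul0r.
have KD k l : K k -> K l -> K (k.1 + l.1, k.2 + l.2).
  move=> [s s0 ->] [t t0 ->]; exists (s + t); first exact: addr_ge0.
  by rewrite /= scalerDl mulrDl opprD.
have KZ a k : 0 < a -> K k -> K (a *: k.1, a * k.2).
  move=> a0 [t t0 ->]; exists (a * t); first by rewrite mulr_ge0// ltW.
  by rewrite /= scalerA mulrN mulrA.
have qK k : K k -> 0 <= q k.1 + k.2.
  by move=> [t t0 ->] /=; rewrite qt// subrr.
have qE : cone_infconv q K = q.
  apply: qmin; first exact: cone_infconv_sublinear.
  move=> y; have := cone_infconv_le sq K0 qK y K0.
  by rewrite /= !addr0.
have K1 : K (x, - q x) by exists 1 => //; rewrite scale1r mul1r.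
have := cone_infconv_le sq K0 qK (- x) K1.
rewrite qE /= addNr sublinear0// => h.
have := sublinearN x sq; lra.
Qed.

Lemma odd_sublinear_linear q : sublinear q -> (forall x, q (- x) = - q x) ->
  linear (q : V -> R^o).
Proof.
move=> sq qN.
have qD x y : q (x + y) = q x + q y.
  apply/eqP; rewrite eq_le sq.1/=.
  by have := sq.1 (- x) (- y); rewrite -opprD !qN; lra.
have qZ a x : q (a *: x) = a * q x.
  have [a0|a0|->] := ltgtP a 0; last by rewrite scale0r sublinear0// mul0r.
    by rewrite -[a]opprK scaleNr qN sq.2 ?oppr_gt0// [RHS]mulNr.
  exact: sq.2.
by move=> a x y; rewrite qD qZ.
Qed.

(** Zorn's lemma gives a minimal sublinear functional below [p]; minimality makes it odd, hence
    linear. *)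
Lemma hahn_banach p : sublinear p ->
  exists f : {linear V -> R^o}, forall x, (f x : R) <= p x.
Proof.
move=> sp.
pose T := {q : V -> R | sublinear q /\ forall x, q x <= p x}.
(* The order is reversed, so that a maximal element for Zorn is a minimal functional. *)
pose ge : rel T := fun s t => `[< forall x, sval t x <= sval s x >].
have [| | | |[q [sq qp]] qmin] := @Zorn T ge.
- by move=> t; apply/asboolP.
- by move=> r s t /asboolP rs /asboolP st; apply/asboolP => x; exact: le_trans (rs x).
- move=> s t /asboolP st /asboolP ts.
  move: s t st ts => [s ps] [t pt] /= st ts; apply: eq_exist.
  by apply/funext => x; apply/le_anti; rewrite st ts.
- move=> A Atot; have [[t0 At0]|A0] := pselect (A !=set0); last first.
    have pp : sublinear p /\ forall x, p x <= p x by [].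
    by exists (exist _ p pp) => s As; exfalso; apply: A0; exists s.
  have [|q Cq|q q' [s As <-] [t At <-]|q sq qC] :=
      @chain_inf_sublinear p (@sval _ _ @` A).
  + by exists (sval t0), t0.
  + by case: Cq => -[q' pq'] _ <-.
  + by have [/asboolP|/asboolP] := Atot _ _ As At; [right|left].
  have qp x : q x <= p x.
    by apply: le_trans ((svalP t0).2 x); apply: qC; exists t0.
  exists (exist _ q (conj sq qp)) => s As; apply/asboolP => x /=.
  by apply: qC; exists s.
have qN : forall x, q (- x) = - q x.
  apply: minimal_sublinear_odd => // q' sq' q'q.
  have q'p x : q' x <= p x by exact: le_trans (qp x).
  by have /(congr1 sval) := qmin (exist _ q' (conj sq' q'p)) (asboolT q'q).
have lq := odd_sublinear_linear sq qN.
pose f := HB.pack_for {linear V -> R^o} (q : V -> R^o)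
  (GRing.isLinear.Build R V R^o _ (q : V -> R^o) lq).
by exists f.
Qed.

End HahnBanach.

(* The sandwich theorem between -e|.| and p, obtained by applying Hahn-Banach
   to the infimal convolution of p and e|.|. *)
Lemma hahn_banach_norm (R : realType) (W : normedModType R) (p : W -> R) (e : R) :
  sublinear p -> 0 <= e -> (forall x, - (e * `|x|) <= p x) ->
  exists f : {linear W -> R^o},
    (forall x, (f x : R) <= p x) /\ forall x, `|f x : R| <= e * `|x|.
Proof.
move=> sp e0 pe.
pose K := [set k : W * R | e * `|k.1| <= k.2].
have K0 : K (0, 0) by rewrite /K/= normr0 mulr0.
have KD k l : K k -> K l -> K (k.1 + l.1, k.2 + l.2).
  rewrite /K/= => Kk Kl; apply: le_trans (lerD Kk Kl).
  by rewrite -mulrDr ler_wpM2l// ler_normD.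
have KZ a k : 0 < a -> K k -> K (a *: k.1, a * k.2).
  move=> a0; rewrite /K/= => Kk; rewrite normrZ gtr0_norm// mulrCA.
  by rewrite ler_wpM2l// ltW.
have pK k : K k -> 0 <= p k.1 + k.2.
  by rewrite /K/=; have := pe k.1; lra.
have le := cone_infconv_le sp K0 pK.
have [f fq] := hahn_banach (cone_infconv_sublinear sp K0 KD KZ pK).
have fe x : (f x : R) <= e * `|x|.
  have Kx : K (- x, e * `|x|) by rewrite /K/= normrN.
  have := le x _ Kx; rewrite /= subrr sublinear0// add0r.
  exact: le_trans.
exists f; split=> x.
  by apply: le_trans (fq x) _; have := le x _ K0; rewrite /= !addr0.
by rewrite ler_norml fe andbT lerNl -[leLHS]raddfN (le_trans (fe _))// normrN.
Qed.

(** * Clarke's derivative and gradient *)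

Section Clarke.
Context {R : realType} {X : completeNormedModType R}.
Implicit Types (Phi : X -> R) (x v w : X) (a e k r t : R).

Lemma locally_lipschitzP Phi : locally_lipschitz Phi -> forall x,
  exists k r, [/\ 0 < k, 0 < r & forall u w, `|x - u| < r -> `|x - w| < r ->
    `|Phi u - Phi w| <= k * `|u - w|].
Proof.
move=> Phi_lip x; have [U xU /pinfty_ex_gt0 [k k0 kU]] := Phi_lip x.
have /nbhs_ballP [r /= r0 rU] := xU.
exists k, r; split=> // u w xu xw; apply: (kU (u, w)); split; apply: rU;
  by rewrite -ball_normE.
Qed.

Lemma locally_lipschitz_continuous Phi : locally_lipschitz Phi -> continuous Phi.
Proof.
move=> /locally_lipschitzP Phi_lip x.
have [k [r [k0 r0 kr]]] := Phi_lip x.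
apply/cvgrPdist_le => e e0; apply/nbhs_ballP.
exists (Num.min r (e / k)) => /=; first by rewrite lt_min r0 divr_gt0.
move=> w; rewrite -ball_normE /= lt_min => /andP[wr we].
apply: le_trans (kr _ _ _ wr) _; first by rewrite subrr normr0.
by rewrite mulrC -ler_pdivlMr// ltW.
Qed.

Lemma clarke_derivative_lt Phi x v a : (clarke_derivative Phi x v < a%:E)%E ->
  exists2 r, 0 < r & forall w t, `|x - w| < r -> 0 < t < r ->
    Phi (w + t *: v) - Phi w <= a * t.
Proof.
rewrite /clarke_derivative limf_esupE => /ereal_inf_lt [_ [V [[A B] [/= xA B0] AB] <-] Va].
have /nbhs_ballP [r1 /= r10 rA] := xA.
have [r2 /= r20 rB] := B0.
exists (Num.min r1 r2); first by rewrite lt_min r10.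
move=> w t; rewrite !lt_min => /andP[wr _] /and3P[t0 _ tr].
rewrite -ler_pdivrMr// -lee_fin; apply: le_trans (ltW Va).
apply: ereal_sup_ubound; exists (w, t) => //; apply: AB; split => /=.
  by apply: rA; rewrite -ball_normE.
by apply: (rB t) => //; rewrite /ball_/= sub0r normrN gtr0_norm.
Qed.

Lemma clarke_derivative_le Phi x v a r : 0 < r ->
  (forall w t, `|x - w| < r -> 0 < t < r -> Phi (w + t *: v) - Phi w <= a * t) ->
  (clarke_derivative Phi x v <= a%:E)%E.
Proof.
move=> r0 Pr; rewrite /clarke_derivative limf_esupE.
pose V := [set wt : X * R | `|x - wt.1| < r /\ 0 < wt.2 < r].
apply: (@le_trans _ _ (ereal_sup ((fun wt : X * R =>
    ((Phi (wt.1 + wt.2 *: v) - Phi wt.1) / wt.2)%:E) @` V))).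
  apply: ereal_inf_lbound; exists V => //.
  exists (ball x r, [set t | 0 < t < r]).
    split => /=; first exact: nbhsx_ballx.
    exists r => //= t; rewrite /ball_/= sub0r normrN => tr t0; rewrite t0/=.
    by rewrite -[t]gtr0_norm.
  by move=> [w t] /= []; rewrite -ball_normE.
apply: ge_ereal_sup => _ [[w t] [/= wr tr] <-].
by rewrite lee_fin ler_pdivrMr ?Pr//; case/andP: tr.
Qed.

Lemma clarke_derivative_ge Phi x v a r : 0 < r ->
  (forall w t, `|x - w| < r -> 0 < t < r -> a * t <= Phi (w + t *: v) - Phi w) ->
  (a%:E <= clarke_derivative Phi x v)%E.
Proof.
move=> r0 Pr; rewrite leNgt; apply/negP => lta.
(* A real [b] below [a] is picked by cases, as the limsup could a priori be infinite. The midpoint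
   of [a] and [b] is then a strict upper bound, violated by quotients based at [x]. *)
have [b /andP[bl ba]] : exists b, (clarke_derivative Phi x v <= b%:E)%E && (b < a).
  move: lta; case: (clarke_derivative Phi x v) => [b| |] /=.
  - by rewrite lte_fin => ba; exists b; rewrite lexx.
  - by rewrite ltNge leey.
  - by move=> _; exists (a - 1); rewrite leNye ltrBlDr ltrDl ltr01.
have : (clarke_derivative Phi x v < ((a + b) / 2)%:E)%E.
  by apply: le_lt_trans bl _; rewrite lte_fin; lra.
move=> /clarke_derivative_lt [s s0 Ps].
pose t := Num.min r s / 2.
have m0 : 0 < Num.min r s by rewrite lt_min r0.
have mr : Num.min r s <= r by rewrite ge_min lexx.
have ms : Num.min r s <= s by rewrite ge_min lexx orbT.
have xx (z : R) : 0 < z -> `|x - x| < z by rewrite subrr normr0.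
have tr : 0 < t < r by rewrite /t; lra.
have ts : 0 < t < s by rewrite /t; lra.
have := Ps x t (xx _ s0) ts; have := Pr x t (xx _ r0) tr.
move=> h1 h2; have := le_trans h1 h2; rewrite ler_pM2r; last by case/andP: tr.
by lra.
Qed.

Lemma dual_norm_le (f : {linear X -> R^o}) e : 0 <= e ->
  (forall v, `|f v : R| <= e * `|v|) -> dual_norm f <= e.
Proof.
move=> e0 fe; apply: ge_sup; first by exists `|f 0 : R|, 0 => //=; rewrite normr0.
move=> _ [v /= v1 <-]; apply: le_trans (fe v) _.
by rewrite -[leRHS]mulr1 ler_wpM2l.
Qed.

(** [dual_norm] is a supremum in [R], meaningful only for bounded functionals; the constant [k]
    provides that here and in the next two lemmas. *)
Lemma dual_norm_has_ubound (f : {linear X -> R^o}) k : 0 <= k ->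
  (forall v, `|f v : R| <= k * `|v|) ->
  has_ubound [set `|f v : R| | v in [set v : X | `|v| <= 1]].
Proof.
move=> k0 fk; exists k => _ [w /= w1 <-]; apply: le_trans (fk w) _.
by rewrite -[leRHS]mulr1 ler_wpM2l.
Qed.

Lemma dual_norm_ge0 (f : {linear X -> R^o}) k : 0 <= k ->
  (forall v, `|f v : R| <= k * `|v|) -> 0 <= dual_norm f.
Proof.
move=> k0 fk; apply: (ub_le_sup (dual_norm_has_ubound k0 fk)).
by exists 0 => /=; rewrite ?raddf0 normr0.
Qed.

Lemma le_dual_norm (f : {linear X -> R^o}) k : 0 <= k ->
  (forall v, `|f v : R| <= k * `|v|) ->
  forall v, `|f v : R| <= dual_norm f * `|v|.
Proof.
move=> k0 fk v; have [->|v0] := eqVneq v 0.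
  by rewrite raddf0 !normr0 mulr0.
have vgt0 : 0 < `|v| by rewrite normr_gt0.
rewrite -ler_pdivrMr//; apply: (ub_le_sup (dual_norm_has_ubound k0 fk)).
exists (`|v|^-1 *: v) => /=; first by rewrite normrZ normfV normr_id mulVf ?gt_eqF.
by rewrite linearZ/= normrM normfV normr_id mulrC.
Qed.

Section Lipschitz.
Variables (Phi : X -> R) (x : X).
Hypothesis Phi_lip : locally_lipschitz Phi.

Lemma clarke_derivative_bounded : exists2 k, 0 < k & forall v,
  ((- (k * `|v|))%:E <= clarke_derivative Phi x v <= (k * `|v|)%:E)%E.
Proof.
have [k [r [k0 r0 kr]]] := locally_lipschitzP Phi_lip x.
exists k => // v.
have v1 : 0 < 1 + `|v| by rewrite ltr_wpDr.
(* The base point and the increment each use at most [r / 2], so [w + t *: v] stays in the ball of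
   radius [r]. Adding 1 covers [v = 0]. *)
pose s := r / 2 / (1 + `|v|).
have s0 : 0 < s by rewrite !divr_gt0.
have key w t : `|x - w| < s -> 0 < t < s ->
    `|Phi (w + t *: v) - Phi w| <= k * `|v| * t.
  move=> xw /andP[t0 ts].
  have sr : s * (1 + `|v|) = r / 2 by rewrite divfK ?gt_eqF.
  have s2 : s <= r / 2 by rewrite -sr ler_peMr ?lerDl// ltW.
  have tv : t * `|v| <= r / 2.
    by rewrite -sr; apply: ler_pM => //; [exact: ltW|exact: ltW|rewrite lerDr].
  apply: le_trans (kr _ _ _ _) _.
  - rewrite opprD addrA (le_lt_trans (ler_normB _ _))// normrZ gtr0_norm//; lra.
  - lra.
  by rewrite addrAC subrr add0r normrZ gtr0_norm// mulrAC mulrA.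
apply/andP; split.
  apply: (clarke_derivative_ge s0) => w t xw ts.
  by have := key _ _ xw ts; rewrite ler_norml mulNr => /andP[].
apply: (clarke_derivative_le s0) => w t xw ts.
exact: le_trans (ler_norm _) (key _ _ xw ts).
Qed.

Lemma clarke_derivative_fin v :
  (fine (clarke_derivative Phi x v))%:E = clarke_derivative Phi x v.
Proof.
have [k _ /(_ v)] := clarke_derivative_bounded.
by case: (clarke_derivative Phi x v) => //= /andP[].
Qed.

(** Subadditivity splits the increment at [w + t *: u], an admissible base point because the limsup
    lets the base point move. Homogeneity rescales the step [t] to [t * a]. *)
Lemma clarke_derivative_sublinear :
  sublinear (fun v => fine (clarke_derivative Phi x v)).
Proof.
have lt v e : 0 < e ->
    (clarke_derivative Phi x v < (fine (clarke_derivative Phi x v) + e)%:E)%E.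
  by move=> e0; rewrite -[ltLHS]clarke_derivative_fin lte_fin ltrDl.
split=> [u v|].
  apply/ler_addgt0Pr => e e0; rewrite -lee_fin clarke_derivative_fin.
  have e20 : 0 < e / 2 by rewrite divr_gt0.
  have [r r0 Pr] := clarke_derivative_lt (lt u _ e20).
  have [s s0 Ps] := clarke_derivative_lt (lt v _ e20).
  have u1 : 0 < 1 + `|u| by rewrite ltr_wpDr.
  pose m := Num.min r (s / 2 / (1 + `|u|)).
  have m0 : 0 < m by rewrite lt_min r0 !divr_gt0.
  apply: (clarke_derivative_le m0) => w t; rewrite !lt_min.
  move=> /andP[xwr xws] /and3P[t0 tr ts].
  pose d := s / 2 / (1 + `|u|).
  have sr : d * (1 + `|u|) = s / 2 by rewrite divfK ?gt_eqF.
  have d0 : 0 < d by rewrite !divr_gt0.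
  have s2 : d <= s / 2 by rewrite -sr ler_peMr ?lerDl// ltW.
  have tv : t * `|u| <= s / 2.
    by rewrite -sr; apply: ler_pM => //; [exact: ltW|exact: ltW|rewrite lerDr].
  have h1 : Phi (w + t *: u) - Phi w <= (fine (clarke_derivative Phi x u) + e / 2) * t.
    by apply: Pr => //; rewrite t0.
  have h2 : Phi (w + t *: u + t *: v) - Phi (w + t *: u) <=
      (fine (clarke_derivative Phi x v) + e / 2) * t.
    apply: Ps => //; last by rewrite t0 /=; move: ts; rewrite -/d; lra.
    rewrite opprD addrA (le_lt_trans (ler_normB _ _))// normrZ gtr0_norm//.
    by move: xws; rewrite -/d; lra.
  by rewrite scalerDr addrA; lra.
have aux a v : 0 < a -> fine (clarke_derivative Phi x (a *: v)) <=
    a * fine (clarke_derivative Phi x v).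
  move=> a0; apply/ler_addgt0Pr => e e0; rewrite -lee_fin clarke_derivative_fin.
  have ea0 : 0 < e / a by rewrite divr_gt0.
  have [r r0 Pr] := clarke_derivative_lt (lt v _ ea0).
  have m0 : 0 < Num.min r (r / a) by rewrite lt_min r0 divr_gt0.
  apply: (clarke_derivative_le m0) => w t; rewrite !lt_min.
  move=> /andP[xwr _] /and3P[t0 _]; rewrite ltr_pdivlMr// => ta.
  rewrite scalerA; apply: le_trans (Pr _ _ xwr _) _; first by rewrite mulr_gt0.
  have -> : a * fine (clarke_derivative Phi x v) + e =
      a * (fine (clarke_derivative Phi x v) + e / a).
    by rewrite mulrDr (mulrC a (e / a)) divfK// gt_eqF.
  by rewrite le_eqVlt; apply/orP; left; apply/eqP; ring.
move=> a v a0; apply/eqP; rewrite eq_le aux//= mulrC -ler_pdivlMr// mulrC.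
have := aux a^-1 (a *: v); rewrite invr_gt0 scalerA mulVf ?gt_eqF// scale1r.
exact.
Qed.

(** The least norm is the smallest [e >= 0] with [- (e * |v|)] below the Clarke derivative: the norm
    of any gradient element is such an [e], and the sandwich theorem produces an element whose norm
    is at most the infimum of these [e]. *)
Lemma min_dual_norm_clarke_gradient : exists2 m,
  is_minimum [set dual_norm y | y in clarke_gradient Phi x] m &
  forall e, 0 <= e ->
    (forall v, `|v| <= 1 -> ((- e)%:E <= clarke_derivative Phi x v)%E) -> m <= e.
Proof.
have [k k0 gk] := clarke_derivative_bounded.
have sg := clarke_derivative_sublinear.
have gE v := clarke_derivative_fin v.
set g := (fun v => fine _) in sg; rewrite -/(g _) in gE.
have gle v : g v <= k * `|v| by have /andP[_] := gk v; rewrite -gE lee_fin.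
have gge v : - (k * `|v|) <= g v by have /andP[+ _] := gk v; rewrite -gE lee_fin.
pose E := [set e | 0 <= e /\ forall v, - (e * `|v|) <= g v].
have hE : has_inf E by split; [exists k; split=> //; exact: ltW|exists 0 => e []].
have m0 : 0 <= inf E by apply: lb_le_inf hE.1 _ => e [].
have mg v : - (inf E * `|v|) <= g v.
  have [->|v0] := eqVneq v 0.
    by rewrite normr0 mulr0 oppr0 sublinear0.
  have vgt0 : 0 < `|v| by rewrite normr_gt0.
  rewrite lerNl -ler_pdivrMr//; apply: lb_le_inf hE.1 _ => e [_ /(_ v)].
  by rewrite lerNl -ler_pdivrMr.
have mE e : E e -> inf E <= e by move=> Ee; apply: ge_inf hE.2 _ Ee.
have grad_ge y : clarke_gradient Phi x y -> inf E <= dual_norm y.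
  move=> [_ yg]; have {}yg v : (y v : R) <= g v by rewrite -lee_fin gE.
  have yk v : `|y v : R| <= k * `|v|.
    rewrite ler_norml (le_trans (yg v))// andbT lerNl -[leLHS]raddfN.
    by rewrite (le_trans (yg _))// (le_trans (gle _))// normrN.
  have yN := le_dual_norm (ltW k0) yk.
  apply: mE; split; first exact: dual_norm_ge0 (ltW k0) yk.
  by move=> v; have := yN v; rewrite ler_norml => /andP[h _]; exact: le_trans (yg v).
have [f [fg fm]] := hahn_banach_norm sg m0 mg.
have f_grad : clarke_gradient Phi x f.
  split; last by move=> v; rewrite -gE lee_fin.
  apply/linear_bounded_continuous/linear_boundedP.
  near=> r => v; apply: le_trans (fm v) _.
  by rewrite ler_wpM2r//; near: r; apply: nbhs_pinfty_ge; rewrite num_real.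
exists (inf E).
  split; last by move=> _ [y yg <-]; exact: grad_ge.
  exists f => //; apply/eqP; rewrite eq_le grad_ge// andbT.
  exact: dual_norm_le.
move=> e e0 eg; apply: mE; split=> // v.
have [->|v0] := eqVneq v 0.
  by rewrite normr0 mulr0 oppr0 sublinear0.
have vgt0 : 0 < `|v| by rewrite normr_gt0.
have := eg (`|v|^-1 *: v); rewrite normrZ normfV normr_id mulVf ?gt_eqF// => /(_ (lexx _)).
rewrite -gE -/(g _) lee_fin sg.2 ?invr_gt0//.
by rewrite mulrC ler_pdivlMr// mulNr.
Unshelve. all: by end_near. Qed.

End Lipschitz.
End Clarke.

(** * The Brezis-Browder principle and paths *)

(** Repeatedly choosing a point that nearly minimises [f] above the current one gives a chain with
    upper bound [l]. An element above [l] with a smaller value would force every step to lower [f]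
    by a fixed amount, against the lower bound [b]. *)
Lemma brezis_browder (R : realType) (T : Type) (le : T -> T -> Prop)
    (A : set T) (f : T -> R) (b : R) :
  (forall x, le x x) -> (forall y x z, le x y -> le y z -> le x z) ->
  (forall x y, le x y -> f y <= f x) -> (forall x, A x -> b <= f x) ->
  (forall u : nat -> T, (forall n, A (u n)) -> (forall n, le (u n) (u n.+1)) ->
    exists2 l, A l & forall n, le (u n) l) ->
  forall x0, A x0 ->
  exists x, [/\ A x, le x0 x & forall y, A y -> le x y -> f x <= f y].
Proof.
move=> le_refl le_trans le_f fb chain x0 Ax0.
pose up x := [set f y | y in [set y | A y /\ le x y]].
have lb_up x : has_lbound (up x) by exists b => _ [y [/fb + _] <-].
(* The choice closes at least half of the gap between [f x] and the infimum of [f] above [x]. *)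
have /choice [g gP] x : exists y, A x ->
    [/\ A y, le x y & f y <= (f x + inf (up x)) / 2].
  have [Ax|nAx] := pselect (A x); last by exists x.
  have fx : inf (up x) <= f x by apply: ge_inf => //; exists x.
  have [e0|e0] := ltP (inf (up x)) (f x); last by exists x; split=> //; lra.
  have d0 : 0 < (f x - inf (up x)) / 2 by rewrite divr_gt0// subr_gt0.
  have hi : has_inf (up x) by split => //; exists (f x), x.
  have [_ [y [Ay xy] <-] fy] := inf_adherent d0 hi.
  by exists y; split=> //; lra.
pose u n := iter n g x0.
have Au n : A (u n) by elim: n => [|n /gP[]].
have leu n : le (u n) (u n.+1) by have [] := gP _ (Au n).
have [l Al ul] := chain u Au leu.
exists l; split=> //; first exact: (ul 0%N).
move=> y Ay ly; rewrite leNgt; apply/negP => yl.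
pose d := f l - f y.
(* Halving the gap gives [2 * f (u n.+1) <= f (u n) + f y], while [f l <= f (u n.+1)]. *)
have step n : f (u n.+1) <= f (u n) - d.
  have [_ _ fu] := gP _ (Au n).
  have yu : inf (up (u n)) <= f y.
    by apply: ge_inf => //; exists y => //; split=> //; exact: le_trans ly.
  have := le_f _ _ (ul n.+1); rewrite -/(u n.+1) in fu *; rewrite /d; lra.
have fu n : f (u n) <= f x0 - n%:R * d.
  elim: n => [|n IH]; first by rewrite mul0r subr0.
  by have := step n; rewrite -natr1 mulrDl mul1r; lra.
have d0 : 0 < d by rewrite subr_gt0.
have := archi_boundP (normr_ge0 ((f x0 - b) / d)).
set n := Num.bound _; have := ler_norm ((f x0 - b) / d).
move=> h1 h2; have := le_lt_trans h1 h2; rewrite ltr_pdivrMr//.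
by have := fu n; have := fb _ (Au n); lra.
Qed.

Section Paths.
Context {R : realType} {X : completeNormedModType R}.
Implicit Types (Phi : X -> R) (S : set X) (c : R -> X) (x y z : X) (t : R).

Lemma dist_to_le x y S : S y -> dist_to x S <= `|x - y|.
Proof. by move=> Sy; apply: ge_inf; [exists 0 => _ [z _ <-]|exists y]. Qed.

Lemma dist_to_ge0 x S : S !=set0 -> 0 <= dist_to x S.
Proof.
move=> [y Sy]; apply: lb_le_inf; first by exists `|x - y|, y.
by move=> _ [z _ <-].
Qed.

Lemma dist_to_lt x S e : S !=set0 -> dist_to x S < e ->
  exists2 y, S y & `|x - y| < e.
Proof.
move=> [y0 Sy0] de; have e0 : 0 < e - dist_to x S by rewrite subr_gt0.
have hi : has_inf [set `|x - y| | y in S].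
  by split; [exists `|x - y0|, y0|exists 0 => _ [z _ <-]].
have [_ [y Sy <-] ye] := inf_adherent e0 hi.
by exists y => //; rewrite /dist_to in ye; lra.
Qed.

Lemma dist_to_lipschitz x y S : S !=set0 ->
  dist_to x S <= dist_to y S + `|x - y|.
Proof.
move=> [z0 Sz0]; rewrite -lerBlDr; apply: lb_le_inf.
  by exists `|y - z0|, z0.
move=> _ [z Sz <-]; rewrite lerBlDr; apply: le_trans (dist_to_le x Sz) _.
by rewrite [leRHS]addrC ler_distD.
Qed.

Lemma dist_to_gt0 x S : S !=set0 -> closed S -> ~ S x -> 0 < dist_to x S.
Proof.
move=> S0 cS nSx.
have /nbhs_ballP [r /= r0 rS] : nbhs x (~` S).
  by apply: open_nbhs_nbhs; split=> //; exact: closed_openC.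
apply: (lt_le_trans r0); apply: lb_le_inf.
  by have [y Sy] := S0; exists `|x - y|, y.
move=> _ [y Sy <-]; rewrite leNgt; apply/negP => xy.
by apply: (rS y) => //; rewrite -ball_normE.
Qed.

(** If the path avoided [S], the indicator of [U0] along it would be locally constant, hence
    continuous, and would take the value 1/2 by the intermediate value theorem. *)
Lemma separates_path S z0 z1 c : separates S z0 z1 -> paths z0 z1 c ->
  exists2 t, 0 <= t <= 1 & S (c t).
Proof.
move=> [_ [U0 [U1 [SO [oU0 oU1] U01 U0z U1z]]]] [cc c0 c1].
apply: contrapT => noS.
have cO t : 0 <= t <= 1 -> U0 (c t) \/ U1 (c t).
  move=> t01; have : (~` S) (c t) by move=> St; apply: noS; exists t.
  by rewrite SO.
have disj x : U0 x -> U1 x -> False by move=> a b; have : set0 x by rewrite -U01.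
pose f t : R := \1_U0 (c t).
have cf : {within `[0, 1], continuous f}.
  apply/subspace_continuousP => t /= t01.
  have /subspace_continuousP/(_ t t01) ct := cc.
  have near_const (O : set X) : open O -> O (c t) ->
      (forall s, 0 <= s <= 1 -> O (c s) -> f t = f s) ->
      f s @[s --> within `[0, 1] (nbhs t)] --> f t.
    move=> oO Ot Oc; apply: cvg_near_cst.
    have : within `[0, 1] (nbhs t) (c @^-1` O).
      by apply: ct; apply: open_nbhs_nbhs.
    rewrite /within /=; apply: filterS => s Os s01.
    rewrite /= in_itv/= in s01.
    by rewrite (Oc s)// ; exact: Os.
  have t01' : 0 <= t <= 1 by rewrite in_itv/= in t01.
  have [U0t|U1t] := cO t t01'.
    apply: (near_const U0) => // s s01 U0s.
    by rewrite /f !indicE !mem_set.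
  apply: (near_const U1) => // s s01 U1s.
  by rewrite /f !indicE !memNset// => /disj; exact.
have f0 : f 0 = 1 by rewrite /f c0 indicE mem_set.
have f1 : f 1 = 0 by rewrite /f c1 indicE memNset// => /disj; exact.
have [|t _] := @IVT R f 0 1 (1 / 2) ler01 cf.
  by rewrite f0 f1 /Num.min /Num.max ltr10; apply/andP; split; lra.
rewrite /f indicE; case: (_ \in _) => /=; lra.
Qed.

(** The infimum is a genuine one: the straight segment is a path, and [Phi z0] bounds every maximum
    from below. *)
Lemma minimax_value_path Phi z0 z1 e : continuous Phi -> 0 < e ->
  exists2 c, paths z0 z1 c &
    forall t, 0 <= t <= 1 -> Phi (c t) <= minimax_value Phi z0 z1 + e.
Proof.
move=> cPhi e0.
set M := [set m | exists2 c, paths z0 z1 c &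
                 is_maximum [set Phi (c t) | t in `[0, 1]] m].
have Mc c : paths z0 z1 c -> exists m, M m.
  move=> pc; have [cc _ _] := pc.
  have cPc : {within `[0, 1], continuous (Phi \o c)}.
    apply/subspace_continuousP => t t01; apply: continuous_cvg; first exact: cPhi.
    by move/subspace_continuousP : cc; exact.
  have [t t01 tmax] := EVT_max ler01 cPc.
  exists (Phi (c t)), c => //; split; first by exists t.
  by move=> _ [s s01 <-]; exact: tmax.
have M0 : has_inf M.
  split.
    apply: (Mc (fun t => z0 + t *: (z1 - z0))); split.
    - apply: continuous_subspaceT => t; apply: cvgD; first exact: cvg_cst.
      by apply: cvgZr_tmp; exact: cvg_id.
    - by rewrite scale0r addr0.
    - by rewrite scale1r addrC subrK.
  exists (Phi z0) => m [c [_ <- _] [_ ub]]; apply: ub; exists 0 => //.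
  by rewrite /= in_itv/= lexx ler01.
have [m [c pc [_ ub]] me] := inf_adherent e0 M0.
exists c => // t t01; apply: le_trans (ltW me); apply: ub.
by exists t => //=; rewrite in_itv.
Qed.

(** Telescoping bounds [k * |c n t - c m t|] by [a n - a m] uniformly in [t]; since [a] decreases
    and is bounded below, the paths are uniformly Cauchy and their limit is continuous. *)
Lemma path_limit (c : nat -> R -> X) (a : nat -> R) (k b : R) : 0 < k ->
  (forall n, {within `[0, 1], continuous (c n)}) ->
  (forall n, b <= a n) ->
  (forall n t, 0 <= t <= 1 -> k * `|c n t - c n.+1 t| <= a n - a n.+1) ->
  exists l : R -> X, {within `[0, 1], continuous l} /\
    forall t, 0 <= t <= 1 ->
      c n t @[n --> \oo] --> l t /\
      forall n, k * `|c n t - l t| <= a n - inf (range a).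
Proof.
move=> k0 cc ab cstep.
have a_step n : a n.+1 <= a n.
  rewrite -subr_ge0; apply: le_trans (cstep n 0 _); last by rewrite lexx ler01.
  by rewrite mulr_ge0 // ltW.
have cnm t n m : 0 <= t <= 1 -> (n <= m)%N ->
    k * `|c n t - c m t| <= a n - a m.
  move=> t01 /subnK <-; elim: (m - n)%N => [|i IH].
    by rewrite !subrr normr0 mulr0.
  rewrite addSn.
  have h := ler_distD (c (i + n)%N t) (c n t) (c (i + n).+1 t).
  have := ler_wpM2l (ltW k0) h; rewrite mulrDr.
  by have := cstep (i + n)%N t t01; lra.
have ha : has_inf (range a) by split; [exists (a 0%N), 0%N|exists b => _ [n _ <-]].
have ia n : inf (range a) <= a n by apply: ge_inf ha.2 _ _; exists n.
have a_near e : 0 < e -> exists N, forall n, (N <= n)%N -> a n < inf (range a) + e.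
  move=> e0; have [_ [N _ <-] aN] := inf_adherent e0 ha.
  exists N => n Nn; apply: le_lt_trans aN.
  have /nonincreasing_seqP h : forall n, a n.+1 <= a n by [].
  exact: h.
have c_cvg t : 0 <= t <= 1 -> cvg (c n t @[n --> \oo]).
  move=> t01; apply/cauchy_cvgP/cauchy_exP => e e0.
  have ke0 : 0 < k * e by rewrite mulr_gt0.
  have [N aN] := a_near _ ke0; exists (c N t).
  exists N => // n /= Nn; rewrite -ball_normE /= -(ltr_pM2l k0).
  apply: le_lt_trans (cnm _ _ _ t01 Nn) _.
  by have := aN N (leqnn N); have := ia n; lra.
pose l t := lim (c n t @[n --> \oo]).
have cl t n : 0 <= t <= 1 -> k * `|c n t - l t| <= a n - inf (range a).
  move=> t01; apply/ler_addgt0Pr => e e0.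
  have ek0 : 0 < e / k by rewrite divr_gt0.
  have /cvgrPdist_lt/(_ _ ek0)[N _ lN] := c_cvg t t01.
  pose m := maxn N n.
  have lm : k * `|l t - c m t| < e.
    rewrite mulrC -ltr_pdivlMr//; apply: lN; exact: leq_maxl.
  have := cnm t n m t01 (leq_maxr N n).
  have := ler_wpM2l (ltW k0) (ler_distD (c m t) (c n t) (l t)).
  by rewrite mulrDr (distrC (c m t)); have := ia m; lra.
exists l; split; last first.
  by move=> t t01; split; [exact: c_cvg|move=> n; exact: cl].
apply/subspace_continuousP => t t01; apply/cvgrPdist_lt => e e0.
have ke0 : 0 < k * (e / 3) by rewrite mulr_gt0// divr_gt0.
have [N /(_ _ (leqnn N)) aN] := a_near _ ke0.
have close s : 0 <= s <= 1 -> `|c N s - l s| < e / 3.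
  by move=> s01; rewrite -(ltr_pM2l k0); have := cl s N s01; lra.
have /subspace_continuousP/(_ t t01)/cvgrPdist_lt ct := cc N.
have e30 : 0 < e / 3 by rewrite divr_gt0.
have := ct _ e30; rewrite !near_withinE; apply: filterS => s ts s01.
have h1 : `|c N t - c N s| < e / 3 by exact: ts.
have h2 := close t t01.
have h3 := close s s01.
have := ler_distD (c N t) (l t) (l s).
have := ler_distD (c N s) (c N t) (l s).
by rewrite (distrC (l t) (c N t)); lra.
Qed.

End Paths.

(** * Descent along a path *)

Section Descent.
Context {R : realType} {X : completeNormedModType R}.
Implicit Types (c : R -> X) (v w : X) (a b h r s t : R).

Lemma seq_lower_bound (I : eqType) (l : seq I) (f : I -> R) :
  (forall i, i \in l -> 0 < f i) ->
  exists2 m, 0 < m & forall i, i \in l -> m <= f i.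
Proof.
elim: l => [|i l IH] fl; first by exists 1.
have [|m m0 ml] := IH; first by move=> j jl; apply: fl; rewrite inE jl orbT.
exists (Num.min (f i) m); first by rewrite lt_min fl ?mem_head.
move=> j; rewrite inE => /predU1P[->|/ml]; first by rewrite ge_min lexx.
by move=> mj; rewrite ge_min mj orbT.
Qed.

(** Compactness extracts finitely many balls of radius [r t]; tent functions on them, divided by
    their sum, form the partition. *)
Lemma segment_partition_of_unity (r : R -> R) :
  (forall t, 0 <= t <= 1 -> 0 < r t) ->
  exists (l : seq R) (lam : R -> R -> R),
    [/\ forall i, i \in l -> 0 <= i <= 1,
        forall i t, 0 <= t <= 1 -> 0 <= lam i t,
        forall i t, 0 <= t <= 1 -> lam i t != 0 -> `|i - t| < r i,
        forall t, 0 <= t <= 1 -> \sum_(i <- l) lam i t = 1 &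
        forall i, {within `[0, 1], continuous (lam i)}].
Proof.
move=> r0; have := @segment_compact R 0 1; rewrite compact_cover.
move=> /(_ R `[0, 1]%classic (fun t => ball t (r t))) [||D D01 Dcov].
- by move=> t _; exact: ball_open.
- move=> t /= t01; exists t => //; apply: ballxx; apply: r0.
  by rewrite in_itv in t01.
(* Twice the positive part of [r i - |i - t|]. *)
pose chi i t := (r i - `|i - t|) + `|r i - `|i - t| |.
have chi_ge0 i t : 0 <= chi i t.
  by rewrite /chi; have := ler_norm (- (r i - `|i - t|)); rewrite normrN; lra.
have chi_supp i t : chi i t != 0 -> `|i - t| < r i.
  move=> h; rewrite ltNge; apply: contra h => h.
  rewrite -subr_le0 in h; by rewrite /chi (ler0_norm h) subrr.
pose l : seq R := enum_fset D.
pose tot t := \sum_(i <- l) chi i t.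
have tot_gt0 t : 0 <= t <= 1 -> 0 < tot t.
  move=> t01; have [i /= iD it] : cover [set` D] (fun t => ball t (r t)) t.
    by apply: Dcov; rewrite /= in_itv.
  rewrite /tot (bigD1_seq i) ?fset_uniq//= ltr_pwDl//; last exact: sumr_ge0.
  move: it; rewrite -ball_normE /= /chi => it.
  have d0 : 0 < r i - `|i - t| by rewrite subr_gt0.
  by rewrite (gtr0_norm d0) addr_gt0.
have chi_cont i : continuous (chi i).
  move=> t; have h : (r i - `|i - s|) @[s --> t] --> r i - `|i - t|.
    apply: cvgB; first exact: cvg_cst.
    by apply: cvg_norm; apply: cvgB; [exact: cvg_cst|exact: cvg_id].
  by apply: cvgD => //; exact: cvg_norm.
have tot_cont : continuous tot.
  move=> t; apply: cvg_big => [|i _]; last exact: chi_cont.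
  exact: add_continuous.
exists l, (fun i t => chi i t / tot t); split.
- by move=> i /D01 /set_mem; rewrite /= in_itv.
- by move=> i t t01; rewrite divr_ge0// ltW// tot_gt0.
- by move=> i t t01; rewrite mulf_eq0 negb_or => /andP[/chi_supp].
- by move=> t t01; rewrite -mulr_suml divff// gt_eqF// tot_gt0.
move=> i; apply/subspace_continuousP => t /=; rewrite in_itv/= => t01.
apply: cvg_within_filter; apply: cvgM; first exact: chi_cont.
by apply: cvgV; [rewrite gt_eqF// tot_gt0|exact: tot_cont].
Qed.

(* Pieces of a path that can be pushed down individually are pushed
   simultaneously: the weighted moves are performed one after the other, each
   contributing its share of the total descent. *)
Lemma path_descent (phi : X -> R) c (K : set R) a k : 0 < k ->
  {within `[0, 1], continuous c} ->
  (forall t, 0 <= t <= 1 -> phi (c t) <= a) ->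
  (forall t, 0 <= t <= 1 -> exists v r, [/\ 0 < r, `|v| <= 1,
     v = 0 \/ (forall s, 0 <= s <= 1 -> `|t - s| < r -> ~ K s) &
     forall s w h b, 0 <= s <= 1 -> `|t - s| < r -> `|c s - w| < r ->
       0 <= h < r -> 0 <= b < r ->
       phi w <= a - b -> phi (w + h *: v) <= a - b - k * h]) ->
  exists c' h, [/\ 0 < h, {within `[0, 1], continuous c'},
    forall t, 0 <= t <= 1 -> K t -> c' t = c t &
    forall t, 0 <= t <= 1 -> `|c t - c' t| <= h /\ phi (c' t) <= a - k * h].
Proof.
move=> k0 cc ca push.
have /choice [vr vrP] t : exists vr : X * R, 0 <= t <= 1 -> [/\ 0 < vr.2, `|vr.1| <= 1,
     vr.1 = 0 \/ (forall s, 0 <= s <= 1 -> `|t - s| < vr.2 -> ~ K s) &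
     forall s w h b, 0 <= s <= 1 -> `|t - s| < vr.2 -> `|c s - w| < vr.2 ->
       0 <= h < vr.2 -> 0 <= b < vr.2 ->
       phi w <= a - b -> phi (w + h *: vr.1) <= a - b - k * h].
  have [/push [v [r P]]|nt] := boolP (0 <= t <= 1); first by exists (v, r).
  by exists (0, 0).
pose v t := (vr t).1; pose r t := (vr t).2.
have [|l [lam [l01 lam0 lamr lam1 lamc]]] := @segment_partition_of_unity r.
  by move=> t /vrP[].
have [|m m0 ml] := @seq_lower_bound _ l r; first by move=> i /l01 /vrP[].
(* As [2 * h + k * h = m], displacements up to [h] and descents up to [k * h] stay below every
   radius [r i]. *)
pose h := m / (2 + k).
have k20 : 0 < 2 + k by rewrite addr_gt0.
have h0 : 0 < h by rewrite divr_gt0.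
have hm : h * 2 + k * h = m.
  by rewrite (mulrC k) -mulrDr divfK// gt_eqF.
have kh0 : 0 < k * h by rewrite mulr_gt0.
pose c' t := c t + h *: \sum_(i <- l) lam i t *: v i.
have v1 i : i \in l -> `|v i| <= 1 by move=> /l01 /vrP[].
(* Induction on the pieces still to be applied, from any current point [w] and descent [b]; what is
   used plus what remains must stay within the budgets [h] and [k * h]. *)
have step t l' : 0 <= t <= 1 -> {subset l' <= l} -> forall w b, 0 <= b ->
    `|c t - w| + h * \sum_(i <- l') lam i t <= h ->
    b + k * h * \sum_(i <- l') lam i t <= k * h ->
    phi w <= a - b ->
    phi (w + h *: \sum_(i <- l') lam i t *: v i) <=
      a - b - k * h * \sum_(i <- l') lam i t.
  move=> t01; elim: l' => [|i l' IH] ll w b b0.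
    by rewrite !big_nil scaler0 !mulr0 !addr0 subr0.
  have il : i \in l by apply: ll; exact: mem_head.
  have {}ll : {subset l' <= l} by move=> j jl; apply: ll; rewrite inE jl orbT.
  rewrite !big_cons; set L := \sum_(i <- l') lam i t.
  have L0 : 0 <= L by apply: sumr_ge0 => j _; exact: lam0.
  have li0 := lam0 i t t01.
  rewrite scalerDr addrA scalerA !mulrDr => hw hb phw.
  have hli0 : 0 <= h * lam i t by rewrite mulr_ge0// ltW.
  have hL0 : 0 <= h * L by rewrite mulr_ge0// ltW.
  have khL0 : 0 <= k * h * L by rewrite mulr_ge0// ltW.
  have khli : 0 <= k * h * lam i t by rewrite mulr_ge0// ltW.
  have phw' : phi (w + h * lam i t *: v i) <= a - (b + k * h * lam i t).
    (* A zero weight is treated apart, since [t] may then lie outside the range where piece [i] can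
       be pushed. *)
    have [->|ln0] := eqVneq (lam i t) 0.
      by rewrite !mulr0 scale0r !addr0.
    have [_ _ _ P] := vrP i (l01 i il).
    have itr := lamr i t t01 ln0.
    have mi := ml i il.
    have cw0 := normr_ge0 (c t - w).
    have := P t w (h * lam i t) b t01 itr; rewrite -/(r i) -/(v i).
    move=> /(_ _ _ _ phw); rewrite opprD addrA mulrA; apply.
    - by lra.
    - by apply/andP; split=> //; lra.
    - by apply/andP; split=> //; lra.
  apply: le_trans (IH ll _ _ _ _ _ phw') _.
  - by rewrite addr_ge0.
  - apply: le_trans hw; rewrite addrA lerD2r opprD addrA.
    apply: le_trans (ler_normB _ _) _; rewrite lerD2l normrZ ger0_norm//.
    by rewrite -[leRHS]mulr1 ler_wpM2l// v1.
  - by rewrite -addrA.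
  by rewrite /L; lra.
exists c', h; split=> //.
- apply/subspace_continuousP => t t01; apply: cvgD.
    by move/subspace_continuousP : cc; exact.
  apply: cvgZl_tmp; apply: cvg_big => [|i _]; first exact: add_continuous.
  by apply: cvgZr_tmp; move/subspace_continuousP : (lamc i); exact.
(* A piece with nonzero weight at a point of [K] has zero direction. *)
- move=> t t01 Kt; rewrite /c' big_seq big1 ?scaler0 ?addr0// => i il.
  have [->|ln0] := eqVneq (lam i t) 0; first by rewrite scale0r.
  have [_ _ [v0|nK] _] := vrP i (l01 i il); first by rewrite /v v0 scaler0.
  by have := nK t t01 (lamr i t t01 ln0).
move=> t t01; split.
  rewrite /c' opprD addrA subrr sub0r normrN normrZ gtr0_norm//.
  rewrite -[leRHS]mulr1 ler_pM2l// -(lam1 t t01).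
  apply: le_trans (ler_norm_sum _ _ _) _; rewrite big_seq [leRHS]big_seq.
  apply: ler_sum => i il; rewrite normrZ ger0_norm ?lam0//.
  by rewrite -[leRHS]mulr1 ler_wpM2l ?lam0 ?v1.
have := step t l t01 (fun _ => id) (c t) 0 (lexx _).
rewrite lam1// !mulr1 subr0 subrr normr0 !add0r !lexx.
by move=> /(_ isT isT (ca t t01)).
Qed.

End Descent.

(** * Near-critical points *)

Section NearCritical.
Context {R : realType} {X : completeNormedModType R}.
Implicit Types (Phi : X -> R) (S F : set X) (c : R -> X) (x y z : X).

Definition plateau S (rho : R) x : R := Num.max 0 (rho - dist_to x S).

Lemma plateau_ge0 S rho x : 0 <= plateau S rho x.
Proof. by rewrite le_max lexx. Qed.

Lemma plateau_le S rho x : 0 <= rho -> S !=set0 -> plateau S rho x <= rho.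
Proof.
by move=> r0 /(dist_to_ge0 x) d0; rewrite ge_max r0 /= gerBl.
Qed.

Lemma plateau_mem S rho x : S x -> rho <= plateau S rho x.
Proof.
move=> Sx; rewrite le_max; apply/orP; right; have := dist_to_le x Sx.
by rewrite subrr normr0; lra.
Qed.

Lemma plateau_far S rho x : rho <= dist_to x S -> plateau S rho x = 0.
Proof. by move=> h; apply/max_idPl; rewrite subr_le0. Qed.

Lemma plateau_lipschitz S rho x y : S !=set0 ->
  plateau S rho x <= plateau S rho y + `|x - y|.
Proof.
move=> S0; rewrite [leLHS]/plateau ge_max addr_ge0 ?plateau_ge0//=.
have := dist_to_lipschitz y x S0; rewrite (distrC y).
have : rho - dist_to y S <= plateau S rho y by rewrite le_max lexx orbT.
lra.
Qed.

Lemma plateau_continuous S rho : S !=set0 -> continuous (plateau S rho).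
Proof.
move=> S0 x; apply/cvgrPdist_lt => e e0; apply/nbhs_ballP; exists e => //= y.
rewrite -ball_normE /= => xy; rewrite ltr_norml.
have := plateau_lipschitz rho x y S0; have := plateau_lipschitz rho y x S0.
by rewrite (distrC y); lra.
Qed.

Lemma within01_near c t e : {within `[0, 1], continuous c} -> 0 <= t <= 1 ->
  0 < e -> exists2 d, 0 < d & forall s, 0 <= s <= 1 -> `|t - s| < d ->
    `|c t - c s| < e.
Proof.
move=> /subspace_continuousP cc t01 e0.
have /cc/cvgrPdist_lt/(_ _ e0) : (`[0, 1]%classic : set R) t by rewrite /= in_itv.
rewrite near_withinE => /nbhs_ballP [d /= d0 dc]; exists d => // s s01 ts.
by apply: dc; rewrite /= ?in_itv// -ball_normE.
Qed.

(* Points below the level are not moved at all; points at the level are moved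
   along a direction in which Clarke's derivative is < -2k, which outweighs
   the k-Lipschitz perturbation k psi. *)
Lemma local_push Phi (psi : X -> R) (k a : R) x : 0 < k ->
  continuous Phi -> continuous psi ->
  (forall y z, psi y <= psi z + `|y - z|) ->
  Phi x + k * psi x <= a ->
  (Phi x + k * psi x = a ->
    exists2 v, `|v| <= 1 & (clarke_derivative Phi x v < (- (2 * k))%:E)%E) ->
  exists v (r : R), [/\ 0 < r, `|v| <= 1, v = 0 \/ Phi x + k * psi x = a &
    forall w h b, `|x - w| < r -> 0 <= h < r -> 0 <= b < r ->
      Phi w + k * psi w <= a - b ->
      Phi (w + h *: v) + k * psi (w + h *: v) <= a - b - k * h].
Proof.
move=> k0 cPhi cpsi psi_lip; rewrite le_eqVlt => /predU1P[xa|xa] /(_ _) hv.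
  have [v v1 /clarke_derivative_lt[r r0 rv]] := hv xa.
  exists v, r; split=> //; first by right.
  move=> w h b xw /andP[+ hr] /andP[b0 br] wb.
  rewrite le_eqVlt => /predU1P[<-|h0].
    by rewrite scale0r addr0 mulr0 subr0.
  have Phi_h := rv w h xw; rewrite h0 hr in Phi_h; have {}Phi_h := Phi_h isT.
  have := psi_lip (w + h *: v) w.
  rewrite addrAC subrr add0r normrZ gtr0_norm// => psi_h.
  have hv1 : h * `|v| <= h by rewrite -[leRHS]mulr1 ler_pM2l.
  have : k * psi (w + h *: v) <= k * (psi w + h).
    by rewrite ler_pM2l//; lra.
  by rewrite mulrDr; lra.
have cphi : continuous (fun y => Phi y + k * psi y).
  move=> y; apply: cvgD; first exact: cPhi.
  by apply: cvgM; [exact: cvg_cst|exact: cpsi].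
pose th := a - (Phi x + k * psi x).
have th0 : 0 < th by rewrite subr_gt0.
have th20 : 0 < th / 2 by rewrite divr_gt0.
have /cvgrPdist_lt/(_ _ th20)/nbhs_ballP[r /= r0 rP] := cphi x.
(* The gap [th] is shared out: [th / 2] for the variation of the perturbed functional, [th / 4] for
   [b] and [th / 4] for [k * h]. *)
have k40 : 0 < th / 4 / k by rewrite !divr_gt0.
exists 0, (Num.min r (Num.min (th / 4) (th / 4 / k))); split.
- by rewrite !lt_min r0 k40 divr_gt0.
- by rewrite normr0.
- by left.
move=> w h b; rewrite !lt_min => /and3P[xw _ _] /and4P[h0 _ _].
rewrite ltr_pdivlMr// => hk /and4P[b0 _ bt _] _.
have := rP w; rewrite -ball_normE /= => /(_ xw).
by rewrite ltr_norml scaler0 addr0 => /andP[h1 h2]; move: h1 h2 hk bt; rewrite /th; lra.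
Qed.

Lemma near_critical Phi z0 z1 F (e : R) : locally_lipschitz Phi ->
  separates (F `&` superlevel Phi (minimax_value Phi z0 z1)) z0 z1 -> 0 < e ->
  exists x, [/\ dist_to x F < e, `|Phi x - minimax_value Phi z0 z1| < e &
    forall v, `|v| <= 1 -> ((- e)%:E <= clarke_derivative Phi x v)%E].
Proof.
move=> Phi_lip; set g := minimax_value Phi z0 z1.
set S := F `&` superlevel Phi g => S_sep e0; apply: contrapT => no_crit.
have cPhi := locally_lipschitz_continuous Phi_lip.
have [cS [U0 [U1 [SU _ _ U0z U1z]]]] := S_sep.
have S0 : S !=set0.
  have [c pc _] := minimax_value_path z0 z1 cPhi ltr01.
  by have [t _ St] := separates_path S_sep pc; exists (c t).
have nS0 : ~ S z0 by change ((~` S) z0); rewrite SU; left.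
have nS1 : ~ S z1 by change ((~` S) z1); rewrite SU; right.
have d0 := dist_to_gt0 S0 cS nS0.
have d1 := dist_to_gt0 S0 cS nS1.
(* The bound 1 controls levels, [e / 2] controls distances to [F], and the last two terms keep [z0]
   and [z1] outside the perturbed region. *)
pose rho := Num.min (Num.min 1 (e / 2)) (Num.min (dist_to z0 S) (dist_to z1 S)).
have rho0 : 0 < rho by rewrite !lt_min ltr01 d0 d1 divr_gt0.
have [rho1 rhoe rhoz0 rhoz1] : [/\ rho <= 1, rho <= e / 2,
    rho <= dist_to z0 S & rho <= dist_to z1 S].
  by rewrite /rho; split; rewrite !ge_min lexx ?orbT.
pose k := e / 2.
have k0 : 0 < k by rewrite divr_gt0.
have kE : 2 * k = e by rewrite /k; lra.
pose psi := plateau S rho.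
pose phi x := Phi x + k * psi x.
have kr0 : 0 < k * rho by rewrite mulr_gt0.
have krk : k * rho <= k by rewrite -[leRHS]mulr1 ler_pM2l.
have cpsi : continuous psi by exact: plateau_continuous.
have cphi : continuous phi.
  move=> y; apply: cvgD; first exact: cPhi.
  by apply: cvgM; [exact: cvg_cst|exact: cpsi].
have psi_rho x : k * psi x <= k * rho.
  by rewrite ler_pM2l//; apply: plateau_le => //; exact: ltW.
have kr20 : 0 < k * rho / 2 by rewrite divr_gt0.
have [c0 pc0 c0g] := minimax_value_path z0 z1 cPhi kr20.
have [cc0 c00 c01] := pc0.
pose K := [set t : R | rho <= dist_to (c0 t) S].
pose A := [set s : (R -> X) * R | [/\ {within `[0, 1], continuous s.1},
  forall t, 0 <= t <= 1 -> K t -> s.1 t = c0 t &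
  forall t, 0 <= t <= 1 -> phi (s.1 t) <= s.2]].
(* Moving from [s] to [u] must lower the level by at least [k] times the displacement, for each [t]
   separately, so no supremum has to be formed. *)
pose below (s u : (R -> X) * R) :=
  forall t : R, 0 <= t <= 1 -> k * `|s.1 t - u.1 t| <= s.2 - u.2.
have below_refl s : below s s by move=> t _; rewrite !subrr normr0 mulr0.
have below_trans u s w : below s u -> below u w -> below s w.
  move=> su uw t t01; have := su t t01; have := uw t t01.
  have := ler_wpM2l (ltW k0) (ler_distD (u.1 t) (s.1 t) (w.1 t)).
  by rewrite mulrDr; lra.
have t00 : 0 <= (0 : R) <= 1 by rewrite lexx ler01.
have t11 : 0 <= (1 : R) <= 1 by rewrite lexx ler01.
have below_snd s u : below s u -> u.2 <= s.2.
  move=> /(_ 0 t00); have := normr_ge0 (s.1 0 - u.1 0).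
  by move=> n0; have := mulr_ge0 (ltW k0) n0; lra.
have K0 : K 0 by rewrite /K /= c00.
have K1 : K 1 by rewrite /K /= c01.
(* Where the path crosses [S], [Phi] is at least [g] and [psi] at least [rho]. *)
have A_lb s : A s -> g + k * rho <= s.2.
  move=> [cs Ks sphi].
  have ps : paths z0 z1 s.1 by split; rewrite ?Ks.
  have [t t01 St] := separates_path S_sep ps.
  apply: (le_trans _ (sphi t t01)); rewrite /phi lerD//; first exact: St.2.
  by rewrite ler_pM2l//; exact: plateau_mem.
(* This level exceeds the bound of [A_lb] by [k * rho / 2], so every admissible pair below it has a
   path within [rho / 2] of [c0]. *)
have A0 : A (c0, g + k * rho / 2 + k * rho).
  by split=> //= t t01; rewrite /phi lerD// c0g.
have chain (u : nat -> (R -> X) * R) : (forall n, A (u n)) ->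
    (forall n, below (u n) (u n.+1)) -> exists2 l, A l & forall n, below (u n) l.
  move=> Au leu.
  have [l [cl lP]] := @path_limit R X (fun n => (u n).1) (fun n => (u n).2) k
    (g + k * rho) k0 (fun n => let: And3 h _ _ := Au n in h)
    (fun n => A_lb _ (Au n)) leu.
  exists (l, inf (range (fun n => (u n).2))); last first.
    by move=> n t /lP[_]; exact.
  split=> //= t t01.
    move=> Kt; have [lt _] := lP t t01.
    have uE : (fun n => (u n).1 t) = cst (c0 t).
      by apply/funext => n; have [_ h _] := Au n; exact: h.
    by move: lt; rewrite uE => /cvg_lim <- //; rewrite lim_cst.
  apply: lb_le_inf; first by exists (u 0%N).2, 0%N.
  move=> _ [n _ <-]; have [lt _] := lP t t01.
  (* For fixed [n] all later paths stay at level at most [(u n).2]; continuity of [phi] passes this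
     to the limit path. *)
  have phil : phi ((u n).1 t) @[n --> \oo] --> phi (l t).
    by apply: continuous_cvg lt; exact: cphi.
  apply: (cvgr_to_le phil).
  exists n => // m /= nm; have [_ _ h] := Au m; apply: le_trans (h t t01) _.
  apply: below_snd; elim: m nm {h} => [|m IH]; first by rewrite leqn0 => /eqP ->.
  by rewrite leq_eqVlt => /predU1P[->//|/IH h]; exact: below_trans (leu m).
have [[c a] [[/= cc Kc ca] c0c cmin]] :=
  brezis_browder below_refl below_trans below_snd A_lb chain A0.
have /= ag := A_lb (c, a) (And3 cc Kc ca).
have [|c' [h [h0 cc' Kc' c'P]]] := @path_descent R X phi c K a k k0 cc ca.
  move=> t t01.
  (* At a frozen parameter [psi] vanishes, so [phi] is at most [g + k * rho / 2], strictly below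
     [a]. *)
  have top : phi (c t) = a -> dist_to (c0 t) S < rho.
    move=> ta; rewrite ltNge; apply/negP => Kt.
    have := c0g t t01; move: ta; rewrite /phi Kc// /psi plateau_far//= in ag *.
    by rewrite mulr0 addr0; lra.
  have [| |v [r [r0 v1 v0 rP]]] := @local_push Phi psi k a (c t) k0 cPhi cpsi _ (ca t t01).
  - by move=> y z; exact: plateau_lipschitz.
  - move=> ta; have dt := top ta.
    apply: contrapT => nv; apply: no_crit; exists (c t); split.
    (* The distance to [F] is less than [rho + rho / 2], which is at most [3 * e / 4]. *)
    + have [y [Fy _] c0y] := dist_to_lt S0 dt.
      have c0t : `|c0 t - c t| <= rho / 2.
        by rewrite -(ler_pM2l k0); have /= := c0c t t01; lra.
      have : `|c t - y| < e.
        by have := ler_distD (c0 t) (c t) y; rewrite (distrC (c t) (c0 t)); lra.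
      exact: le_lt_trans (dist_to_le _ Fy).
    (* From [g + k * rho <= a <= g + 3 * k * rho / 2] and [0 <= psi <= rho], the level lies between
       [g] and [g + 3 * e / 4]. *)
    + rewrite ltr_norml; have /= := c0c 0 t00; have := psi_rho (c t).
      have := mulr_ge0 (ltW k0) (plateau_ge0 S rho (c t)).
      have := mulr_ge0 (ltW k0) (normr_ge0 (c0 0 - c 0)).
      by move: ta ag; rewrite /phi /= -/psi -/g -kE; lra.
    + move=> v v1; rewrite leNgt; apply/negP => vlt; apply: nv.
      by exists v => //; rewrite kE.
  have r20 : 0 < r / 2 by rewrite divr_gt0.
  have [q q0 qP] := within01_near cc t01 r20.
  have near_w s w : `|c t - c s| < r / 2 -> `|c s - w| < r / 2 -> `|c t - w| < r.
    by have := ler_distD (c s) (c t) w; lra.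
  (* A piece that really moves sits at a parameter outside [K], and continuity of [c0] keeps a
     neighbourhood outside [K]. *)
  have [q' q'0 q'P] : exists2 q', 0 < q' &
      v = 0 \/ forall s, 0 <= s <= 1 -> `|t - s| < q' -> ~ K s.
    have [->|/top tS] := v0; first by exists 1 => //; left.
    have gap : 0 < rho - dist_to (c0 t) S by rewrite subr_gt0.
    have [q' q'0 q'P] := within01_near cc0 t01 gap.
    exists q' => //; right => s s01 ts; rewrite /K /=.
    have := q'P s s01 ts; have := dist_to_lipschitz (c0 s) (c0 t) S0.
    by rewrite (distrC (c0 s)) => h1 h2; apply/negP; rewrite -ltNge; lra.
  exists v, (Num.min (Num.min q q') (r / 2)); split=> //.
  - by rewrite !lt_min q0 q'0.
  - have [->|h] := q'P; [by left|right => s s01].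
    by rewrite !lt_min => /andP[/andP[_ ts] _]; exact: h.
  move=> s w h b s01; rewrite !lt_min => /andP[/andP[ts _] _].
  move=> /andP[_ csw] /andP[h0 /andP[_ hr]] /andP[b0 /andP[_ br]].
  apply: rP; first by apply: (near_w s) => //; exact: qP.
    by rewrite h0 /=; lra.
  by rewrite b0 /=; lra.
have kh0 : 0 < k * h by rewrite mulr_gt0.
(* The lowered pair is admissible and below [(c, a)], so it contradicts the minimality [cmin]. *)
have : a <= a - k * h.
  apply: (cmin (c', a - k * h)).
    split=> //= t t01 => [Kt|]; last by have [] := c'P t t01.
    by rewrite Kc' // Kc.
  move=> t t01 /=; have [cc't _] := c'P t t01.
  by rewrite opprB addrCA subrr addr0 ler_pM2l.
lra.
Qed.

End NearCritical.

(** * Construction of the sequence *)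

Theorem theorem1p10 (R : realType) (X : completeNormedModType R)
    (Phi : X -> R) (Phi_lip : locally_lipschitz Phi)
    (z0 z1 : X) (F : set X) (F_closed : closed F) (F_bounded : bounded_set F)
    (F_sep : separates
       (F `&` superlevel Phi (minimax_value Phi z0 z1)) z0 z1) :
  exists (x : nat -> X) (m : nat -> R),
    [/\ forall n : nat,
          is_minimum [set dual_norm y | y in clarke_gradient Phi (x n)] (m n),
        dist_to (x n) F @[n --> \oo] --> (0 : R),
        Phi (x n) @[n --> \oo] --> minimax_value Phi z0 z1
      & (1 + `|x n|) * m n @[n --> \oo] --> (0 : R)].
Proof.
have e0 n : 0 < (harmonic n : R) by rewrite /harmonic invr_gt0.
have /choice[x xP] n := near_critical Phi_lip F_sep (e0 n).
(* The lower bound 0, needed for squeezing, holds because the minimum is the norm of a bounded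
   functional. *)
have /choice[m mP] n : exists m,
    is_minimum [set dual_norm y | y in clarke_gradient Phi (x n)] m /\
    0 <= m <= harmonic n.
  have [m m_min m_le] := min_dual_norm_clarke_gradient (x n) Phi_lip.
  have [_ _ xn] := xP n.
  have mh : m <= harmonic n by apply: m_le => //; exact: ltW.
  exists m; split=> //; rewrite mh andbT.
  have [[y [_ yg] <-] _] := m_min.
  have [k k0 gk] := clarke_derivative_bounded (x n) Phi_lip.
  apply: (dual_norm_ge0 (ltW k0)) => v.
  have yk w : (y w : R) <= k * `|w|.
    by rewrite -lee_fin (le_trans (yg w))//; have /andP[] := gk w.
  by rewrite ler_norml yk andbT lerNl -[leLHS]raddfN (le_trans (yk _))// normrN.
have F0 : F !=set0.
  have cPhi := locally_lipschitz_continuous Phi_lip.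
  have [c pc _] := minimax_value_path z0 z1 cPhi ltr01.
  by have [t _ [Fct _]] := separates_path F_sep pc; exists (c t).
have [M M0 FM] := pinfty_ex_gt0 F_bounded.
(* [x n] is within 1 of a point of [F], whose norm is at most [M]; the weight is thus bounded and
   the last product is squeezed by a multiple of [harmonic n]. *)
have xM n : 1 + `|x n| <= 2 + M.
  have [xF _ _] := xP n.
  have [y Fy xy] := dist_to_lt F0 xF.
  have h1 : (harmonic n : R) <= 1 by rewrite /harmonic invf_le1// ler1n.
  have := FM y Fy; have := ler_distD y (x n) 0; rewrite !subr0.
  by move=> /= a b; lra.
exists x, m; split.
- by move=> n; have [] := mP n.
- apply: (squeeze_cvgr _ (cvg_cst 0) cvg_harmonic); apply: nearW => n.
  by have [xF _ _] := xP n; rewrite dist_to_ge0// ltW.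
- apply/cvgrPdist_lt => e e_gt0.
  have /cvgrPdist_lt/(_ _ e_gt0) := @cvg_harmonic R.
  apply: filterS => n; rewrite sub0r normrN gtr0_norm// distrC.
  by apply: lt_trans; have [] := xP n.
apply: (@squeeze_cvgr _ _ _ _ (cst 0) (fun n => (2 + M) * harmonic n)).
- apply: nearW => n; have [_ /andP[m0 mh]] := mP n.
  by rewrite mulr_ge0 ?addr_ge0//= ler_pM ?addr_ge0.
- exact: cvg_cst.
by rewrite -[X in _ --> X](mulr0 (2 + M)); apply: cvgM cvg_harmonic; exact: cvg_cst.
Qed.
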